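(* Let $C_1,\ldots,C_m\subseteq\mathcal{E}$ be closed convex sets with $C:=\bigcap_{i=1}^m C_i\neq\emptyset$. Let $\{x^k\}_{k\ge0}\subseteq\mathcal{E}$ be a sequence such that: (1) for every $c\in C$, $\|x^{k+1}-c\|\le\|x^k-c\|$ for all $k$; (2) there exist a positive integer $\ell$ and a nonnegative sequence $\{a_k\}_{k\ge0}$ with $\inf_k a_k>0$ (so $\sum_k a_k=\infty$) such that $$\mathrm{dist}^2(x^k,C)\ge\mathrm{dist}^2(x^{k+\ell},C)+a_k\max_{1\le i\le m}\mathrm{dist}^2(x^k,C_i)\quad\forall\,k.$$ Suppose that $C_1,\ldots,C_m$ satisfy a H\''olderian error bound. Then $\{x^k\}$ converges to some point in $C$ at least with a sublinear rate $O(k^{-p})$ for some $p>0$, i.e. $\mathrm{dist}(x^k,C)=O(k^{-p})$. In particular, if the H\''olderian error bound is uniform with exponent $\gamma\in(0,1]$, then there exist $M>0$ and $\theta\in(0,1)$ such that for any $k\ge2\ell$, $$\mathrm{dist}(x^k,C)\le\begin{cases}M\,k^{-\frac{1}{2(\gamma^{-1}-1)}}&\text{if }\gamma\in(0,1),\\ M\,\theta^k&\text{if }\gamma=1.\end{cases}$$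
   Context: $\mathcal{E}$ is a finite-dimensional real vector space with norm $\|\cdot\|$ induced by an inner product, and $\mathrm{dist}(x,D)=\min_{y\in D}\|x-y\|$ for a nonempty closed convex set $D$. $C_1,\ldots,C_m$ satisfy a H\''olderian error bound if for every bounded set $B\subseteq\mathcal{E}$ there exist $\theta_B>0$ and an exponent $\gamma_B\in(0,1]$ such that $\mathrm{dist}(x,C)\le\theta_B\max_{1\le i\le m}\mathrm{dist}(x,C_i)^{\gamma_B}$ for all $x\in B$. If the same exponent $\gamma_B=\gamma\in(0,1]$ can be taken for all $B$, the bound is uniform (with exponent $\gamma$). *)

(* Defs.v *)
From HB Require Import structures.
From mathcomp Require Import all_boot all_order all_algebra.
From mathcomp Require Import all_classical all_reals all_analysis.

Set Implicit Arguments.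
Unset Strict Implicit.
Unset Printing Implicit Defensive.
Import Order.TTheory GRing.Theory Num.Theory.
Import numFieldNormedType.Exports.
Local Open Scope classical_set_scope.
Local Open Scope ring_scope.

#[short(type="finNormedModType")]
HB.structure Definition FinNormedModule (R : realType) :=
  {V of Vector R V & NormedModule R V}.

Definition norm_induced_by (R : realType) (E : finNormedModType R)
    (ip : {dot E for idfun}) : Prop :=
  forall x : E, `|x| = Num.sqrt (ip x x).

(* The infimum is attained when D is nonempty and closed; it is 0 by the
   convention on [inf] when D is empty. *)
Definition dist (R : realType) (E : finNormedModType R) (x : E) (D : set E)
    : R :=
  inf [set `|x - y| | y in D].

(* Maxima over 'I_m start from 0, which is harmless since all the terms are
   nonnegative. *)
Definition holder_bound_on (R : realType) (E : finNormedModType R) (m : nat)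
    (Cs : 'I_m -> set E) (B : set E) (gamma : R) : Prop :=
  exists2 theta : R, 0 < theta &
    forall x : E, B x ->
      dist x (\bigcap_i Cs i)
        <= theta * \big[Num.max/0]_(i < m) (dist x (Cs i) `^ gamma).

Definition holder_error_bound (R : realType) (E : finNormedModType R)
    (m : nat) (Cs : 'I_m -> set E) : Prop :=
  forall B : set E, bounded_set B ->
    exists2 gamma : R, 0 < gamma <= 1 & holder_bound_on Cs B gamma.

Definition uniform_holder_error_bound (R : realType) (E : finNormedModType R)
    (m : nat) (Cs : 'I_m -> set E) (gamma : R) : Prop :=
  0 < gamma <= 1 /\
  forall B : set E, bounded_set B -> holder_bound_on Cs B gamma.

(* Main.v *)
Require Import Defs.
From HB Require Import structures.
From mathcomp Require Import all_boot all_order all_algebra.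
From mathcomp Require Import all_classical all_reals all_analysis.
From mathcomp Require Import ring lra.
Import Order.TTheory GRing.Theory Num.Theory.
Import numFieldNormedType.Exports.
Local Open Scope classical_set_scope.
Local Open Scope ring_scope.

(** Write [d k] for the distance from [x k] to the intersection [C]. Fejer
    monotonicity keeps the sequence bounded, so one instance of the error bound,
    taken on the range of [x], applies to every term. It turns the decrease
    hypothesis into a scalar recurrence for [b k = d k ^+ 2],
      [b (k + l) <= b k - delta * b k `^ gamma^-1]
    with a constant [delta > 0] ([holder_recurrence]).

    When [gamma = 1] the recurrence is a contraction over [l] steps and [b]
    decays geometrically ([geometric_decay]). When [gamma < 1], put
    [s = gamma^-1 - 1 > 0]: the recurrence makes [b `^ (- s)] grow by at least
    [s * delta] every [l] steps ([recurrence_inverse_growth]), so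
    [b k `^ s] is [O(1 / k)] and [d k] is [O(k `^ (- 1 / (2 * s)))]
    ([power_decay]). For an unspecified exponent, the weaker recurrence with
    [1 + gamma^-1] in place of [gamma^-1] yields some power rate whatever
    [gamma] is.

    In particular [d] tends to [0]. A Fejer monotone sequence satisfies
    [`|x j - x k| <= 2 * d k] for [j >= k], so it is Cauchy, and its limit lies
    in the closed set [C] ([fejer_cvg]). Cauchy sequences converge because in
    finite dimension a vector is a fixed linear combination of its inner
    products with finitely many vectors ([dual_frame], [fin_cauchy_cvg]). *)

Set Implicit Arguments.
Unset Strict Implicit.
Unset Printing Implicit Defensive.

(** * Completeness of a finite-dimensional inner product space *)

Lemma norm_inducedE (R : realType) (E : finNormedModType R)
    (ip : {dot E for idfun}) (norm_ip : norm_induced_by ip) (u : E) :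
  ip u u = `|u| ^+ 2.
Proof.
rewrite norm_ip sqr_sqrtr //; have [->|u0] := eqVneq u 0.
  by rewrite linear0l.
exact: ltW (neq0_dnorm_gt0 u u0).
Qed.

Lemma ip_sym (R : realType) (E : finNormedModType R)
  (ip : {dot E for idfun}) (u v : E) : ip u v = ip v u.
Proof. by rewrite hermC /= expr0 mul1r. Qed.

Lemma cauchy_schwarz (R : realType) (E : finNormedModType R)
    (ip : {dot E for idfun}) (norm_ip : norm_induced_by ip) (u v : E) :
  `|ip u v| <= `|u| * `|v|.
Proof.
have [->|v0] := eqVneq v 0; first by rewrite linear0r !normr0 mulr0.
have vv_gt0 : 0 < ip v v by exact: neq0_dnorm_gt0.
(* The vector is [ip v v] times the component of [u] orthogonal to [v]. *)
have := norm_inducedE norm_ip (ip v v *: u - ip u v *: v).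
rewrite linearBl !linearBr !linearZl_LR !linearZr_LR /= (ip_sym ip v u) => h.
rewrite -(@ler_pXn2r _ 2) ?nnegrE ?mulr_ge0 // exprMn real_normK ?num_real //.
rewrite -!(norm_inducedE norm_ip) -subr_ge0 -(pmulr_rge0 _ vv_gt0).
have -> : ip v v * (ip u u * ip v v - ip u v ^+ 2) =
   `|ip v v *: u - ip u v *: v| ^+ 2.
  by rewrite -h /GRing.scale /=; ring.
exact: sqr_ge0.
Qed.

(** Coordinates become inner products with fixed vectors, which makes them
    continuous: for a basis [b], the map [u |-> \sum_j ip u b_j *: b_j] is
    injective, and applying its inverse to the [b_j] gives the [w_j]. *)
Lemma dual_frame (R : realType) (E : finNormedModType R)
    (ip : {dot E for idfun}) :
  exists n : nat, exists e w : 'I_n -> E,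
    forall u : E, u = \sum_(j < n) ip u (e j) *: w j.
Proof.
pose b := vbasis {:E}.
pose f (u : E) := \sum_(j < \dim {:E}) ip u b`_j *: b`_j.
have f_lin : linear f.
  move=> c u v; rewrite /f scaler_sumr -big_split; apply: eq_bigr => j _ /=.
  by rewrite linearPl /= scalerDl scalerA.
pose fL : {linear E -> E} := HB.pack f (GRing.isLinear.Build R E E _ f f_lin).
have f_inj : lker (linfun fL) == 0%VS.
  apply/eqP/vspaceP => u; rewrite memv_ker memv0 lfunE /=.
  apply/eqP/eqP => [fu0|->]; last exact: (linear0 fL).
  (* Pairing [f u = 0] with [u] gives a vanishing sum of squares. *)
  have coord0 (j : 'I_(\dim {:E})) : ip u b`_j = 0.
    have : \sum_(i < \dim {:E}) ip u b`_i ^+ 2 == 0.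
      apply/eqP; transitivity (ip u (f u)); last by rewrite fu0 linear0r.
      rewrite /f linear_sumr; apply: eq_bigr => i _.
      by rewrite linearZr_LR /= expr2.
    rewrite psumr_eq0 => [/allP /(_ j)|i _]; last exact: sqr_ge0.
    by rewrite mem_index_enum sqrf_eq0 => /(_ isT) /eqP.
  apply/eqP/contraT => /(neq0_dnorm_gt0 (s := ip)).
  rewrite [X in ip u X](coord_vbasis (memvf u)) linear_sumr.
  rewrite big1 ?ltxx // => j _.
  by rewrite linearZr_LR /= coord0 mulr0.
exists (\dim {:E}), (fun j => b`_j), (fun j => (linfun fL)^-1%VF b`_j) => u.
rewrite -[LHS](lker0_lfunK f_inj) lfunE /= /f linear_sum.
by apply: eq_bigr => j _; rewrite linearZ.
Qed.

(** By Cauchy-Schwarz each coefficient in the dual frame is Lipschitz, hence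
    Cauchy along the sequence, hence convergent in [R]. *)
Lemma fin_cauchy_cvg (R : realType) (E : finNormedModType R)
    (ip : {dot E for idfun}) (norm_ip : norm_induced_by ip) (u : nat -> E) :
  cauchy_ex (u @ \oo) -> cvg (u @ \oo).
Proof.
move=> u_cauchy; have [n [e [w uE]]] := dual_frame ip.
have coord_cvg j : cvg (ip (u k) (e j) @[k --> \oo]).
  apply/cauchy_cvgP/cauchy_exP => eps eps0.
  have e1 : 0 < `|e j| + 1 by rewrite ltr_wpDl.
  have [y [N _ uN]] := u_cauchy _ (divr_gt0 eps0 e1).
  exists (ip y (e j)), N => // k Nk; rewrite -ball_normE /ball_ /=.
  have <- : ip (y - u k) (e j) = ip y (e j) - ip (u k) (e j).
    by rewrite linearBl.
  apply: le_lt_trans (cauchy_schwarz norm_ip _ _) _.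
  apply: (@le_lt_trans _ _ (`|y - u k| * (`|e j| + 1))).
    by rewrite ler_wpM2l // lerDl.
  by rewrite -ltr_pdivlMr //; have := uN _ Nk; rewrite -ball_normE.
have [t ct] := choice (fun j => (cvg_ex _).1 (coord_cvg j)).
apply/cvg_ex; exists (\sum_j t j *: w j).
rewrite (_ : u = fun k => \sum_j ip (u k) (e j) *: w j); last first.
  by apply/funext => k; exact: uE.
apply: cvg_big => [|j _]; first exact: add_continuous.
by apply: cvgZr_tmp; exact: ct.
Qed.

(** * Distance to a set *)

Lemma dist_has_lbound (R : realType) (E : finNormedModType R) (D : set E)
    (x : E) :
  has_lbound [set `|x - y| | y in D].
Proof. by exists 0 => _ [y _ <-]. Qed.

Lemma dist_le_norm (R : realType) (E : finNormedModType R) (D : set E)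
    (x y : E) :
  D y -> dist x D <= `|x - y|.
Proof. by move=> Dy; apply: ge_inf; [exact: dist_has_lbound|exists y]. Qed.

Lemma dist_ge0 (R : realType) (E : finNormedModType R) (D : set E) (x : E) :
  0 <= dist x D.
Proof.
have [->|D0] := eqVneq D set0; first by rewrite /dist image_set0 inf0.
apply: lb_le_inf; last by move=> _ [y _ <-].
by move/set0P: D0 => [y Dy]; exists `|x - y|, y.
Qed.

Lemma dist_approx (R : realType) (E : finNormedModType R) (D : set E)
    (x : E) (r : R) :
  D !=set0 -> dist x D < r -> exists2 y, D y & `|x - y| < r.
Proof.
move=> [y0 Dy0] /inf_lt []; first by exists `|x - y0|, y0.
by move=> _ [y Dy <-]; exists y.
Qed.

Lemma le_dist (R : realType) (E : finNormedModType R) (D : set E)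
    (x : E) (r : R) :
  D !=set0 -> (forall y, D y -> r <= `|x - y|) -> r <= dist x D.
Proof.
move=> [y0 Dy0] rD; apply: lb_le_inf; first by exists `|x - y0|, y0.
by move=> _ [y Dy <-]; exact: rD.
Qed.

(** * Fejer monotone sequences *)

Definition fejer_monotone (R : realType) (E : finNormedModType R)
    (D : set E) (x : nat -> E) :=
  forall c, D c -> forall k, `|x k.+1 - c| <= `|x k - c|.

Lemma fejer_le (R : realType) (E : finNormedModType R) (D : set E)
    (x : nat -> E) (c : E) (j k : nat) :
  fejer_monotone D x -> D c -> (j <= k)%N -> `|x k - c| <= `|x j - c|.
Proof.
move=> fej Dc; elim: k => [|k IH]; first by rewrite leqn0 => /eqP ->.
by rewrite leq_eqVlt => /predU1P[->//|/IH]; exact: le_trans (fej _ Dc _).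
Qed.

Lemma fejer_bounded (R : realType) (E : finNormedModType R) (D : set E)
    (x : nat -> E) :
  D !=set0 -> fejer_monotone D x -> bounded_set (range x).
Proof.
move=> [c Dc] fej; exists (`|x 0%N - c| + `|c|); split; first exact: num_real.
move=> M ltM _ [k _ <-]; apply: le_trans (ltW ltM).
rewrite -{1}(subrK c (x k)); apply: le_trans (ler_normD _ _) _.
by rewrite lerD2r (fejer_le fej).
Qed.

Lemma fejer_dist_le (R : realType) (E : finNormedModType R) (D : set E)
    (x : nat -> E) (j k : nat) :
  D !=set0 -> fejer_monotone D x -> (j <= k)%N -> dist (x k) D <= dist (x j) D.
Proof.
move=> D0 fej jk; apply: le_dist => // c Dc.
exact: le_trans (dist_le_norm _ Dc) (fejer_le fej Dc jk).
Qed.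

(** If [c] in [D] is within [eps / 2] of [x N], all later terms stay within
    [eps / 2] of [c], hence within [eps] of [x N]: the sequence is Cauchy. *)
Lemma fejer_cvg (R : realType) (E : finNormedModType R)
    (ip : {dot E for idfun}) (norm_ip : norm_induced_by ip)
    (D : set E) (x : nat -> E) :
  closed D -> D !=set0 -> fejer_monotone D x ->
  dist (x k) D @[k --> \oo] --> (0 : R) -> exists2 c, D c & x @ \oo --> c.
Proof.
move=> Dcl D0 fej /cvgrPdist_lt dist0.
have x_cvg : cvg (x @ \oo).
  apply: (fin_cauchy_cvg norm_ip) => eps eps0.
  have [N _ dN] := dist0 _ (divr_gt0 eps0 (ltr0n R 2)).
  have := dN N (leqnn N); rewrite /= sub0r normrN ger0_norm ?dist_ge0 //.
  case/(dist_approx D0) => c Dc xc; exists (x N), N => // k /= Nk.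
  have := fejer_le fej Dc Nk; rewrite -ball_normE /ball_ /=.
  have := ler_distD c (x N) (x k); rewrite (distrC c); lra.
have [c xc] := (cvg_ex _).1 x_cvg; exists c => //.
apply: Dcl => B /nbhs_ballP[eps /= eps0 ballB].
have eps2 : 0 < eps / 2 by lra.
have [N _ xN] := (cvgrPdist_lt _ _).1 xc _ eps2.
have [N' _ dN] := dist0 _ eps2.
have := xN (maxn N N') (leq_maxl N N').
have := dN (maxn N N') (leq_maxr N N').
rewrite /= sub0r normrN ger0_norm ?dist_ge0 // => /(dist_approx D0)[d Dd xd] cx.
exists d; split => //; apply: ballB; rewrite -ball_normE /ball_ /=.
by have := ler_distD (x (maxn N N')) c d; lra.
Qed.

(** * From the error bound to a scalar recurrence *)

Lemma bigmax_sqr_ge0 (R : realType) (m : nat) (f : 'I_m -> R) :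
  0 <= \big[Num.max/0]_(i < m) (f i ^+ 2).
Proof.
apply: (big_ind (fun z => 0 <= z)) => [//|a b a0 b0|i _]; last exact: sqr_ge0.
by rewrite le_max a0.
Qed.

(** With [mu] the largest squared distance to the sets, the bound reads
    [d <= theta * mu `^ (gamma / 2)], so [mu] is at least a multiple of
    [(d ^+ 2) `^ gamma^-1], and the decrease by [alpha * mu] becomes a
    decrease expressed through [d] alone. *)
Lemma holder_recurrence (R : realType) (E : finNormedModType R) (m : nat)
    (Cs : 'I_m -> set E) (x : nat -> E) (l : nat) (alpha gamma : R) :
  0 < alpha -> 0 < gamma ->
  (forall k, dist (x (k + l)%N) (\bigcap_i Cs i) ^+ 2 +
       alpha * \big[Num.max/0]_(i < m) (dist (x k) (Cs i) ^+ 2)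
     <= dist (x k) (\bigcap_i Cs i) ^+ 2) ->
  holder_bound_on Cs (range x) gamma ->
  exists2 delta : R, 0 < delta & forall k,
    dist (x (k + l)%N) (\bigcap_i Cs i) ^+ 2 <=
      dist (x k) (\bigcap_i Cs i) ^+ 2
      - delta * (dist (x k) (\bigcap_i Cs i) ^+ 2) `^ gamma^-1.
Proof.
move=> alpha0 gamma0 dec [theta theta0 bound].
have T0 : 0 < (theta ^+ 2) `^ gamma^-1 by rewrite powR_gt0 // exprn_gt0.
exists (alpha / (theta ^+ 2) `^ gamma^-1) => [|k]; first exact: divr_gt0.
have := dec k; set d := dist (x k) _; set mu := \big[_/_]_(_ < _) _ => deck.
have d0 : 0 <= d by exact: dist_ge0.
have mu0 : 0 <= mu.
  exact: bigmax_sqr_ge0.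
have d_mu : d <= theta * mu `^ (2^-1 * gamma).
  have xk : range x (x k) by exists k.
  apply: le_trans (bound _ xk) _; rewrite ler_pM2l //.
  apply: bigmax_le => [|i _]; first exact: powR_ge0.
  rewrite powRrM; apply: ge0_ler_powR;
    rewrite ?nnegrE ?dist_ge0 ?powR_ge0 ?(ltW gamma0) //.
  rewrite powR12_sqrt // -(@ler_pXn2r _ 2) ?nnegrE ?dist_ge0 ?sqrtr_ge0 //.
  by rewrite sqr_sqrtr // /mu (le_bigmax _ (fun i => dist (x k) (Cs i) ^+ 2)).
have d2_mu : (d ^+ 2) `^ gamma^-1 <= (theta ^+ 2) `^ gamma^-1 * mu.
  have -> : mu = (mu `^ gamma) `^ gamma^-1.
    by rewrite -powRrM divff ?lt0r_neq0 // powRr1.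
  rewrite -powRM ?powR_ge0 ?sqr_ge0 //.
  apply: ge0_ler_powR; rewrite ?nnegrE ?invr_ge0 ?(ltW gamma0) ?sqr_ge0 //.
    by rewrite mulr_ge0 ?powR_ge0 ?sqr_ge0.
  have -> : theta ^+ 2 * mu `^ gamma = (theta * mu `^ (2^-1 * gamma)) ^+ 2.
    rewrite exprMn -(@powR_mulrn _ (mu `^ _)) ?powR_ge0 // -powRrM.
    by rewrite [_ * gamma * _]mulrAC mulVf ?mul1r ?pnatr_eq0.
  by rewrite ler_pXn2r ?nnegrE ?(mulr_ge0 (ltW theta0)) ?powR_ge0.
have : alpha / (theta ^+ 2) `^ gamma^-1 * (d ^+ 2) `^ gamma^-1 <= alpha * mu.
  by rewrite -mulrA ler_pM2l // mulrC ler_pdivrMr // mulrC.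
by move: deck; lra.
Qed.

(** * Decay rates of scalar recurrences with delay *)

(** Since [b] is bounded, [b `^ (1 + r)] is at most a constant times
    [b `^ r]. The new exponent exceeds [1] when [r > 0], as a power rate
    requires; this covers the linear recurrence [r = 1]. *)
Lemma recurrence_raise_exponent (R : realType) (l : nat) (b : nat -> R)
    (delta r : R) :
  0 < delta -> (forall k, 0 <= b k) -> (forall k, b k <= b 0%N) -> 0 <= r ->
  (forall k, b (k + l)%N <= b k - delta * b k `^ r) ->
  exists2 delta', 0 < delta' &
    forall k, b (k + l)%N <= b k - delta' * b k `^ (1 + r).
Proof.
move=> delta0 b0 bmax r0 rec; have b1 : 0 < b 0%N + 1 by rewrite ltr_wpDl.
exists (delta / (b 0%N + 1)) => [|k]; first exact: divr_gt0.
apply: le_trans (rec k) _; rewrite lerD2l lerN2 -mulrA ler_pM2l //.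
rewrite powRD; last by rewrite gt_eqF // ltr_wpDr.
rewrite powRr1 // mulrA ler_piMl ?powR_ge0 // mulrC ler_pdivrMr // mul1r.
by have := bmax k; lra.
Qed.

(** For positive values this says that [b `^ (- s)] grows by at least
    [s * delta] in one step; the product form also covers [b = 0]. It follows
    from [1 - t <= expR (- t)] raised to the power [s], then
    [1 + s * t <= expR (s * t)], with [t = delta * b `^ s]. *)
Lemma recurrence_inverse_growth (R : realType) (b b' delta s : R) :
  0 <= b -> 0 <= b' -> 0 < s -> 0 < delta ->
  b' <= b - delta * b `^ (1 + s) ->
  b' `^ s * (1 + s * delta * b `^ s) <= b `^ s.
Proof.
move=> b0 b'0 s0 delta0 rec; set u := b `^ s.
have u0 : 0 <= u by exact: powR_ge0.
have b'_le : b' <= b * expR (- (delta * u)).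
  apply: le_trans rec _; rewrite powRD; last by rewrite gt_eqF // addr_gt0.
  rewrite powRr1 // -/u.
  have -> : b - delta * (b * u) = b * (1 + - (delta * u)) by ring.
  by rewrite ler_wpM2l // expR_ge1Dx.
have t0 : 0 <= s * delta * u by rewrite !mulr_ge0 ?(ltW s0) ?(ltW delta0).
have b's_le : b' `^ s <= u * expR (- (s * delta * u)).
  rewrite (_ : - (s * delta * u) = - (delta * u) * s); last by ring.
  rewrite expRM /u -powRM ?expR_ge0 //.
  by apply: ge0_ler_powR; rewrite ?nnegrE ?mulr_ge0 ?expR_ge0 ?(ltW s0).
have t1 : 0 <= 1 + s * delta * u by rewrite addr_ge0.
apply: le_trans (ler_wpM2r t1 b's_le) _.
rewrite -(mulrA u); apply: ler_piMr => //.
rewrite expRN mulrC ler_pdivrMr ?expR_gt0 // mul1r.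
exact: expR_ge1Dx.
Qed.

(** Put [A = l * (u 0 + c^-1)]. The map [v |-> v / (1 + c * v)] sends [A / k] to
    [A / (k + c * A)], which is at most [A / (k + l)] as [l <= c * A]; being
    nondecreasing on nonnegative numbers, it makes the bound [u k <= A / k]
    propagate by steps of [l]. The summand [l * u 0] makes it hold on the first
    [l] indices. *)
Lemma harmonic_decay (R : realType) (l : nat) (u : nat -> R) (c : R) :
  (0 < l)%N -> 0 < c -> (forall k, 0 <= u k) -> (forall k, u k <= u 0%N) ->
  (forall k, u (k + l)%N * (1 + c * u k) <= u k) ->
  forall k, k%:R * u k <= l%:R * (u 0%N + c^-1).
Proof.
move=> l_gt0 c0 u0 umax rec; pose A := l%:R * (u 0%N + c^-1).
have lA : l%:R <= c * A.
  rewrite /A mulrCA mulrDr divff ?lt0r_neq0 // ler_peMr //.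
  by rewrite lerDr mulr_ge0 // ltW.
rewrite -/A => k; elim/ltn_ind: k => k IH; have [kl|lk] := leqP k l.
  apply: (@le_trans _ _ (l%:R * u 0%N)); last first.
    by rewrite ler_wpM2l // lerDl invr_ge0 ltW.
  by apply: ler_pM => //; rewrite ler_nat.
have := IH (k - l)%N; rewrite ltn_subrL l_gt0 (ltn_trans l_gt0 lk) => /(_ isT).
have := rec (k - l)%N; rewrite subnK 1?ltnW // natrB 1?ltnW //.
have kl0 : 0 <= k%:R - l%:R :> R by rewrite subr_ge0 ler_nat ltnW.
move: (u0 k) (u0 (k - l)%N) => uk uj rj IHj.
have d0 : 0 < 1 + c * u (k - l)%N by rewrite ltr_pwDl // mulr_ge0 // ltW.
rewrite -(ler_pM2r d0) -mulrA.
apply: (@le_trans _ _ (k%:R * u (k - l)%N)); first by rewrite ler_wpM2l.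
have : l%:R * u (k - l)%N <= c * A * u (k - l)%N by rewrite ler_wpM2r.
by move: IHj; lra.
Qed.

(** Harmonic decay of [b `^ s], raised to the power [s^-1]. *)
Lemma power_decay (R : realType) (l : nat) (b : nat -> R) (delta s : R) :
  (0 < l)%N -> 0 < s -> 0 < delta ->
  (forall k, 0 <= b k) -> (forall k, b k <= b 0%N) ->
  (forall k, b (k + l)%N <= b k - delta * b k `^ (1 + s)) ->
  exists2 A : R, 0 < A &
    forall k, (0 < k)%N -> b k <= A * k%:R `^ (- s^-1).
Proof.
move=> l0 s0 delta0 b0 bmax rec.
have c0 : 0 < s * delta by exact: mulr_gt0.
pose A := l%:R * (b 0%N `^ s + (s * delta)^-1).
have A0 : 0 < A by rewrite mulr_gt0 ?ltr0n // ltr_wpDl ?powR_ge0 ?invr_gt0.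
exists (A `^ s^-1) => [|k k0]; first exact: powR_gt0.
have kA : k%:R * b k `^ s <= A.
  apply: (@harmonic_decay _ l (fun k => b k `^ s)) => // [j|j|j].
  - exact: powR_ge0.
  - by apply: ge0_ler_powR; rewrite ?nnegrE ?(ltW s0).
  - exact: recurrence_inverse_growth.
have -> : b k = (b k `^ s) `^ s^-1.
  by rewrite -powRrM divff ?lt0r_neq0 // powRr1.
rewrite -mulN1r powRrM powR_inv1 ?ler0n // -powRM ?invr_ge0 ?ler0n ?(ltW A0) //.
apply: ge0_ler_powR;
  rewrite ?nnegrE ?powR_ge0 ?invr_ge0 ?divr_ge0 ?(ltW A0) ?(ltW s0) //.
by rewrite ler_pdivlMr ?ltr0n // mulrC.
Qed.

Lemma geometric_decay (R : realType) (l : nat) (b : nat -> R) (delta : R) :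
  (0 < l)%N -> 0 < delta ->
  (forall k, 0 <= b k) -> (forall k, b k <= b 0%N) ->
  (forall k, b (k + l)%N <= b k - delta * b k) ->
  exists A q : R, [/\ 0 < A, 0 < q < 1 & forall k, b k <= A * q ^+ k].
Proof.
move=> l0 delta0 b0 bmax rec.
(* The contraction factor [1 - delta] may be negative; [(1 + delta)^-1]
   dominates it and always lies in the open unit interval. *)
pose q := (1 + delta)^-1.
have q0 : 0 < q by rewrite invr_gt0 addr_gt0.
have q1 : q < 1 by rewrite invf_lt1 ?addr_gt0 // ltrDl.
have li0 : 0 < l%:R^-1 :> R by rewrite invr_gt0 ltr0n.
(* Taking the [l]-th root spreads the contraction over [l] steps; dividing the
   constant by [q] pays for the first [l] indices. *)
pose t := q `^ l%:R^-1.
have t0 : 0 < t by exact: powR_gt0.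
have tl : t ^+ l = q.
  rewrite -powR_mulrn ?powR_ge0 // -powRrM mulVf ?pnatr_eq0 ?lt0n_neq0 //.
  by rewrite powRr1 // ltW.
have t1 : t < 1.
  by rewrite ltNge; apply/negP => t1; move: q1; rewrite -tl ltNge exprn_ege1.
have A0 : 0 < (b 0%N + 1) / q by rewrite divr_gt0 // ltr_wpDl.
exists ((b 0%N + 1) / q), t; rewrite t0 t1; split => //.
elim/ltn_ind => k IH; have [kl|lk] := ltnP k l.
  apply: le_trans (bmax k) _; apply: (@le_trans _ _ ((b 0%N + 1) / q * t ^+ l)).
    by rewrite tl divfK ?lt0r_neq0 // lerDl.
  by rewrite ler_pM2l // ler_wiXn2l ?(ltW t0) ?(ltW t1) ?(ltnW kl).
rewrite -(subnK lk); apply: le_trans (rec _) _; rewrite exprD tl mulrA.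
have := IH (k - l)%N; rewrite ltn_subrL l0 (leq_trans l0 lk) => /(_ isT) bj.
apply: le_trans (ler_wpM2r (ltW q0) bj); rewrite ler_pdivlMr ?addr_gt0 //.
have -> : (b (k - l)%N - delta * b (k - l)%N) * (1 + delta) =
  b (k - l)%N - delta ^+ 2 * b (k - l)%N by ring.
by rewrite gerBl mulr_ge0 // sqr_ge0.
Qed.

Lemma sqr_le_powR (R : realType) (d A y r : R) :
  0 <= A -> d ^+ 2 <= A * y `^ r -> d <= Num.sqrt A * y `^ (r / 2).
Proof.
move=> A0 dA; apply: le_trans (ler_norm d) _.
rewrite -(@ler_pXn2r _ 2) ?nnegrE ?mulr_ge0 ?sqrtr_ge0 ?powR_ge0 //.
rewrite real_normK ?num_real // exprMn sqr_sqrtr //.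
by rewrite -(@powR_mulrn _ (y `^ _)) ?powR_ge0 // -powRrM divfK ?pnatr_eq0.
Qed.

Lemma powRN_cvg0 (R : realType) (r : R) :
  0 < r -> k%:R `^ (- r) @[k --> \oo] --> (0 : R).
Proof.
move=> r0; apply/cvgrPdist_lt => eps eps0.
have [N _ NP] := nbhs_infty_gtr (eps^-1 `^ r^-1); exists N => // k /= /NP kgt.
have k0 : 0 < k%:R :> R by exact: le_lt_trans (powR_ge0 _ _) kgt.
rewrite sub0r normrN ger0_norm ?powR_ge0 // powRN invf_plt ?posrE ?powR_gt0 //.
have -> : eps^-1 = (eps^-1 `^ r^-1) `^ r.
  by rewrite -powRrM mulVf ?lt0r_neq0 // powRr1 // invr_ge0 ltW.
by apply: gt0_ltr_powR => //; rewrite nnegrE ?powR_ge0 ?ltW.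
Qed.

Unset Implicit Arguments.

Theorem corollary4p9 (R : realType) (E : finNormedModType R)
    (ip : {dot E for idfun}) (norm_ip : norm_induced_by ip)
    (m : nat) (m_gt0 : (0 < m)%N) (Cs : 'I_m -> set E)
    (Cs_closed : forall i, closed (Cs i))
    (Cs_convex : forall i, convex_set (Cs i))
    (C_neq0 : \bigcap_i Cs i !=set0)
    (x : nat -> E)
    (fejer : forall c : E, (\bigcap_i Cs i) c ->
       forall k : nat, `|x k.+1 - c| <= `|x k - c|)
    (l : nat) (l_gt0 : (0 < l)%N)
    (a : nat -> R) (a_ge0 : forall k : nat, 0 <= a k)
    (a_inf : 0 < inf (range a))
    (decrease : forall k : nat,
       dist (x k) (\bigcap_i Cs i) ^+ 2
         >= dist (x (k + l)%N) (\bigcap_i Cs i) ^+ 2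
            + a k * \big[Num.max/0]_(i < m) (dist (x k) (Cs i) ^+ 2))
    (holder : holder_error_bound Cs) :
  (exists c : E, [/\ (\bigcap_i Cs i) c,
      x @ \oo --> c &
      exists2 p : R, 0 < p &
        (fun k : nat => dist (x k) (\bigcap_i Cs i))
          =O_\oo (fun k : nat => k%:R `^ (- p))]) /\
  (forall gamma : R, uniform_holder_error_bound Cs gamma ->
    exists M theta : R, [/\ 0 < M, 0 < theta < 1 &
      forall k : nat, (2 * l <= k)%N ->
        dist (x k) (\bigcap_i Cs i) <=
          if gamma < 1 then M * k%:R `^ (- (1 / (2 * (gamma^-1 - 1))))
          else M * theta ^+ k]).
Proof.
set C := \bigcap_i Cs i; pose d k := dist (x k) C.
have C_closed : closed C by apply: closed_bigI => i _; exact: Cs_closed.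
have d_ge0 k : 0 <= d k by exact: dist_ge0.
have d2_ge0 k : 0 <= d k ^+ 2 by exact: sqr_ge0.
have d2_max k : d k ^+ 2 <= d 0%N ^+ 2.
  by rewrite ler_pXn2r ?nnegrE // fejer_dist_le.
have bnd : bounded_set (range x) by exact: fejer_bounded C_neq0 fejer.
have rec gamma : 0 < gamma -> holder_bound_on Cs (range x) gamma ->
    exists2 delta : R, 0 < delta & forall k,
      d (k + l)%N ^+ 2 <= d k ^+ 2 - delta * (d k ^+ 2) `^ gamma^-1.
  move=> gamma0.
  apply: (@holder_recurrence _ _ _ _ _ _ (inf (range a))) => // k.
  apply: le_trans (decrease k); rewrite lerD2l ler_wpM2r //.
    exact: bigmax_sqr_ge0.
  by apply: ge_inf; [exists 0 => _ [j _ <-]|exists k].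
split.
- have [gamma /andP[gamma0 _] hb] := holder _ bnd.
  have [delta0 delta0_gt0 rec0] := rec _ gamma0 hb.
  have gammaV : 0 < gamma^-1 by rewrite invr_gt0.
  (* The exponent [1 + gamma^-1] avoids a separate treatment of [gamma = 1]; it
     costs a worse power, namely [gamma / 2]. *)
  have [delta delta_gt0 rec1] :=
    recurrence_raise_exponent delta0_gt0 d2_ge0 d2_max (ltW gammaV) rec0.
  have [A A0 dA] := power_decay l_gt0 gammaV delta_gt0 d2_ge0 d2_max rec1.
  have d_le k : (0 < k)%N -> d k <= Num.sqrt A * k%:R `^ (- (gamma / 2)).
    move=> k0; rewrite -mulNr; apply: sqr_le_powR; first exact: ltW.
    by have := dA _ k0; rewrite invrK.
  have dO : d =O_\oo (fun k : nat => k%:R `^ (- (gamma / 2))).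
    apply/eqOP; exists (Num.sqrt A).
    split=> [|M /ltW AM]; first exact: num_real.
    exists 1%N => // k /= k0.
    rewrite ger0_norm // ger0_norm ?powR_ge0 //.
    by apply: le_trans (d_le _ k0) _; rewrite ler_wpM2r ?powR_ge0.
  have d_cvg0 : d k @[k --> \oo] --> (0 : R).
    have gamma2 : 0 < gamma / 2 by exact: divr_gt0.
    apply: squeeze_cvgr (cvg_cst 0) _; last first.
      rewrite -[X in _ --> X](mulr0 (Num.sqrt A)).
      exact: cvgMr (powRN_cvg0 gamma2).
    by exists 1%N => // k /d_le ->; rewrite d_ge0.
  have [c Cc xc] := fejer_cvg norm_ip C_closed C_neq0 fejer d_cvg0.
  by exists c; split => //; exists (gamma / 2) => //; rewrite divr_gt0.
- move=> gamma [/andP[gamma0 gamma1] ub].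
  have [delta delta0 recg] := rec _ gamma0 (ub _ bnd).
  have [g1|g1] := ltP gamma 1.
    pose s := gamma^-1 - 1.
    have s0 : 0 < s by rewrite subr_gt0 invf_gt1.
    have rs k : d (k + l)%N ^+ 2 <= d k ^+ 2 - delta * (d k ^+ 2) `^ (1 + s).
      by rewrite /s (addrC 1) subrK.
    have [A A0 dA] := power_decay l_gt0 s0 delta0 d2_ge0 d2_max rs.
    exists (Num.sqrt A), 2^-1; rewrite sqrtr_gt0 A0; split => [//||k lk].
      by apply/andP; split; lra.
    have -> : - (1 / (2 * (gamma^-1 - 1))) = - s^-1 / 2.
      by rewrite div1r invfM mulrC mulNr.
    apply: sqr_le_powR; first exact: ltW.
    by apply: dA; apply: leq_trans lk; rewrite muln_gt0.
  have {gamma1 g1} gamma1 : gamma = 1 by apply/eqP; rewrite eq_le gamma1.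
  have r1 k : d (k + l)%N ^+ 2 <= d k ^+ 2 - delta * d k ^+ 2.
    by have := recg k; rewrite gamma1 invr1 powRr1.
  have [A [q [A0 /andP[q0 q1] dA]]] :=
    geometric_decay l_gt0 delta0 d2_ge0 d2_max r1.
  exists (Num.sqrt A), (Num.sqrt q); rewrite !sqrtr_gt0 A0 q0.
  split => // [|k _].
    by rewrite -[X in _ < X]sqrtr1 ltr_sqrt.
  rewrite -(@ler_pXn2r _ 2) ?nnegrE;
    rewrite ?dist_ge0 ?mulr_ge0 ?exprn_ge0 ?sqrtr_ge0 //.
  rewrite exprMn (exprAC (Num.sqrt q)) (sqr_sqrtr (ltW A0)).
  by rewrite (sqr_sqrtr (ltW q0)); exact: dA.
Qed.
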